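(* Let $0<\beta<1$. Consider the problem: among all pairs $(p,u)$ with $p>0$ and $u\in W^{1,1}[-p,p]$ nonnegative, satisfying $u(p)=u(-p)=0$ and $\int_{-p}^p u\,dx=1$, minimize $$J[u]=\int_{-p}^p\Big[\sqrt{1+u'(x)^2}-\beta\Big]\,dx.$$ Then there exists a unique minimizer, it is smooth up to the boundary of $[-p,p]$, and it is given by $$u(x)=\sqrt{R^2-x^2}-\beta R,\qquad R^{-1}=\sqrt{\arccos\beta-\beta\sqrt{1-\beta^2}},\qquad p=\sqrt{1-\beta^2}\,R.$$ Furthermore, the graph of $u$ meets the $x$-axis at $\pm p$ with interior angle $\arccos\beta$, i.e. $\frac{1}{\sqrt{1+u'(\pm p)^2}}=\beta$.
   Context: $W^{1,1}[-p,p]$ denotes the Sobolev space of integrable functions on $[-p,p]$ with integrable weak derivative (absolutely continuous functions). The half-width $p>0$ is free (part of the minimization). *)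

(* Defs.v *)
From HB Require Import structures.
From mathcomp Require Import all_boot all_order all_algebra.
From mathcomp Require Import all_classical all_reals all_analysis.
Set Implicit Arguments. Unset Strict Implicit. Unset Printing Implicit Defensive.
Import Order.TTheory GRing.Theory Num.Theory.
Import numFieldNormedType.Exports.
Local Open Scope classical_set_scope.
Local Open Scope ring_scope.

(* W^{1,1}[-p,p]: u is absolutely continuous on [-p,p] with weak derivative g,
   i.e. g is Lebesgue integrable on [-p,p] and u(x) = u(-p) + int_{-p}^x g
   for every x in [-p,p]. *)
Definition W11 {R : realType} (p : R) (u g : R -> R) : Prop :=
  (@lebesgue_measure R).-integrable `[-p, p] (EFin \o g) /\
  forall x, -p <= x <= p ->
    u x = u (-p) + Rintegral (@lebesgue_measure R) `[-p, x] g.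

Definition admissible {R : realType} (p : R) (u g : R -> R) : Prop :=
  0 < p /\ W11 p u g /\
  (forall x, -p <= x <= p -> 0 <= u x) /\
  u p = 0 /\ u (-p) = 0 /\
  (\int[@lebesgue_measure R]_(x in `[(- p)%R, p]) (u x)%:E = 1%:E)%E.

Definition Jfun {R : realType} (beta p : R) (g : R -> R) : \bar R :=
  (\int[@lebesgue_measure R]_(x in `[(- p)%R, p]) (Num.sqrt (1 + g x ^+ 2) - beta)%R%:E)%E.

Definition minimizer {R : realType} (beta p : R) (u : R -> R) : Prop :=
  exists g, admissible p u g /\
    forall q v h, admissible q v h -> (Jfun beta p g <= Jfun beta q h)%E.

(* Main.v *)
Require Import Defs.
From HB Require Import structures.
From mathcomp Require Import all_boot all_order all_algebra.
From mathcomp Require Import all_classical all_reals all_analysis.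
From mathcomp Require Import measurable_realfun ring lra.
Import Order.TTheory GRing.Theory Num.Theory.
Import numFieldNormedType.Exports.
Local Open Scope classical_set_scope.
Local Open Scope ring_scope.
Set Implicit Arguments. Unset Strict Implicit. Unset Printing Implicit Defensive.

(** A calibration argument.  Let [s = sqrt (1 - beta^2)].  Given a competitor
[v] on [[-q, q]] with derivative [h], compare it with the arc of the circle of
radius [r = q / s] whose chord is [[-q, q]]; this arc meets its chord at the
angle [acos beta].  By Cauchy-Schwarz,
[sqrt (1 + h^2) >= (sqrt (r^2 - x^2) - x h) / r], with equality iff
[h = - x / sqrt (r^2 - x^2)].  Fubini gives [int x h = - int v = - 1], so that,
with [A = acos beta - beta s],
[J >= r A + 1 / r >= 2 sqrt A],
where the last step is AM-GM.  Both inequalities are equalities exactly when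
[r = 1 / sqrt A] and [h] is almost everywhere the slope of the circle. *)

(** * Derivatives of the circle and of the area below it *)

Lemma is_derive_circle (R : realType) (r x : R) : x ^+ 2 < r ^+ 2 ->
  is_derive x 1 (fun t => Num.sqrt (r ^+ 2 - t ^+ 2))
    (- x / Num.sqrt (r ^+ 2 - x ^+ 2)).
Proof.
move=> xr; have y0 : 0 < r ^+ 2 - x ^+ 2 by rewrite subr_gt0.
have sy0 : 0 < Num.sqrt (r ^+ 2 - x ^+ 2) by rewrite sqrtr_gt0.
have dsqrt := is_derive1_sqrt y0.
have dg : is_derive x 1 (fun t => r ^+ 2 - t ^+ 2) (- (2 * x)).
  by apply: is_derive_eq; rewrite /GRing.scale /=; ring.
have dc := @is_derive1_comp _ Num.sqrt (fun t => r ^+ 2 - t ^+ 2) _ _ _ dsqrt dg.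
apply: (is_derive_eq dc).
by rewrite /GRing.scale /=; field; rewrite gt_eqF.
Qed.

(** The primitive is the area under the arc between [0] and [t], cut into a circular sector (the
    [asin] term) and a right triangle. *)
Lemma is_derive_circle_area (R : realType) (r x : R) : 0 < r -> -r < x < r ->
  is_derive x 1
    (fun t => (r ^+ 2 * asin (t / r) + t * Num.sqrt (r ^+ 2 - t ^+ 2)) / 2)
    (Num.sqrt (r ^+ 2 - x ^+ 2)).
Proof.
move=> r0 /andP[rx xr].
have x2r2 : x ^+ 2 < r ^+ 2 by nra.
have dc := is_derive_circle x2r2.
have xr1 : -1 < x / r < 1 by rewrite ltr_pdivlMr// ltr_pdivrMr// mulN1r mul1r rx.
have da := is_derive1_asin xr1.
have y0 : 0 < r ^+ 2 - x ^+ 2 by rewrite subr_gt0.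
have sy0 : 0 < Num.sqrt (r ^+ 2 - x ^+ 2) by rewrite sqrtr_gt0.
have sqE : Num.sqrt (1 - (x / r) ^+ 2) = Num.sqrt (r ^+ 2 - x ^+ 2) / r.
  have -> : 1 - (x / r) ^+ 2 = (r ^+ 2 - x ^+ 2) * (r^-1) ^+ 2.
    by field; rewrite gt_eqF.
  by rewrite sqrtrM ?ltW// sqrtr_sqr ger0_norm// invr_ge0 ltW.
have dac : is_derive x 1 (fun t => asin (t / r)) ((Num.sqrt (r ^+ 2 - x ^+ 2))^-1).
  have dg : is_derive x 1 (fun t => t / r) r^-1.
    by apply: is_derive_eq; rewrite /GRing.scale /=; ring.
  have dac := @is_derive1_comp _ (@asin R) (fun t => t / r) _ _ _ da dg.
  apply: (is_derive_eq dac).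
  by rewrite /GRing.scale /= sqE; field; rewrite !gt_eqF.
apply: is_derive_eq; rewrite /GRing.scale /=.
have := sqr_sqrtr (ltW y0).
set y := Num.sqrt _ in sy0 *; move=> y2.
have -> : r ^+ 2 = y ^+ 2 + x ^+ 2 by rewrite y2 subrK.
by field; rewrite gt_eqF.
Qed.

(** * Fubini for a primitive, and the fundamental theorem of calculus *)

(** Fubini on the triangle [a <= y <= x <= b]: the value [g y] is counted once for each [x] in
    [[y, b]], a segment of length [b - y]. This replaces an integration by parts. *)
Lemma integral_primitive (R : realType) (a b : R) (g : R -> R) :
  (@lebesgue_measure R).-integrable `[a, b] (EFin \o g) ->
  (\int[lebesgue_measure]_(x in `[a, b])
      (Rintegral (@lebesgue_measure R) `[a, x] g)%:E =
   \int[lebesgue_measure]_(y in `[a, b]) ((b - y) * g y)%:E)%E.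
Proof.
move=> ig; pose mu := @lebesgue_measure R.
pose gt : R -> R := g \_ `[a, b].
have igt : mu.-integrable setT (EFin \o gt).
  by rewrite -restrict_EFin; apply/integrable_restrict => //=; rewrite setTI.
have mgt : measurable_fun setT gt by apply/measurable_EFinP; exact: measurable_int igt.
(* The kernel is [g y] times the indicator of the triangle, with [z.1] as [x] and [z.2] as [y]; it
   lives on the whole plane so that Fubini applies directly. *)
pose k (z : R * R) : R := \1_(`[a, b] : set R) z.1 * ((z.2 <= z.1)%R%:R * gt z.2).
have mk : measurable_fun [set: R * R] k.
  apply: measurable_funM.
    apply: (measurableT_comp (f := \1_(`[a, b] : set R) : R -> R)) => //.
  apply: measurable_funM; last exact: (measurableT_comp mgt).
  apply: (measurableT_comp (f := fun c : bool => c%:R : R)) => //.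
  exact: measurable_fun_ler.
pose M := (\int[mu]_y `|(gt y)%:E|)%E.
have Mfin : M \is a fin_num.
  by rewrite ge0_fin_numE ?integral_ge0//; case/integrableP : igt.
have ik : (mu \x mu)%E.-integrable setT (EFin \o k).
  apply/integrable12ltyP; first exact/measurable_EFinP.
  (* For fixed [x] the inner integral is at most [M] when [x] is in [[a, b]] and zero otherwise, so
     the total is at most the length of the segment times [M]. *)
  apply: (@le_lt_trans _ _ (\int[mu]_x ((\1_(`[a, b] : set R) x)%:E * M))%E).
    apply: ge0_le_integral => //=.
    - by move=> x _; exact: integral_ge0.
    - apply: (measurable_fun_fubini_tonelli_F (m2 := mu) (fun z => `|(k z)%:E|)%E) => //=.
      apply: measurableT_comp => //; exact: measurableT_comp.
    - apply: emeasurable_funM => //.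
      exact/measurable_EFinP/measurable_indic.
    - move=> x _.
      rewrite /M -ge0_integralZl//; last first.
        by apply: measurableT_comp => //; exact/measurable_EFinP.
      apply: ge0_le_integral => //.
      + apply/measurable_EFinP/measurableT_comp => //.
        exact: (measurableT_comp mk).
      + exact/measurable_funeM/measurable_EFinP/measurableT_comp.
      + move=> y _; rewrite /k /= !normrM EFinM ger0_norm//.
        apply: lee_pmul => //; rewrite lee_fin normr_nat.
        by case: (y <= x); rewrite ?mul1r ?mul0r.
  rewrite ge0_integralZr//; last 2 first.
    exact/measurable_EFinP/measurable_indic.
    exact: integral_ge0.
  rewrite integral_indic// setIT -(fineK Mfin).
  rewrite /= lebesgue_measure_itv/=.
  by case: ifP => _; rewrite ?mul0e// -EFinB -EFinM ltry.
have fub := Fubini ik.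
(* Integrating the kernel in [y] first gives the primitive at [x]. *)
transitivity (\int[mu]_x \int[mu]_y (k (x, y))%:E)%E.
  rewrite integral_mkcond; apply: eq_integral => x _.
  rewrite patchE; case: ifPn => [|xab]; last first.
    rewrite integral0_eq// => y _; rewrite /k/= indicE (negbTE xab) mul0r//.
  rewrite inE/= in_itv/= => /andP[ax xb].
  rewrite /Rintegral fineK; last first.
    apply: integrable_fin_num => //.
    by apply: integrableS ig => //; apply: subset_itvl; rewrite bnd_simp.
  rewrite integral_mkcond; apply: eq_integral => y _.
  rewrite /k/= indicE mem_set ?mul1r/=; last by rewrite in_itv/= ax.
  rewrite /gt !patchE !mem_setE !in_itv/=.
  case: (leP a y) => ay/=; last by rewrite mulr0.
  case: (leP y x) => yx/=; last by rewrite mul0r.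
  by rewrite (le_trans yx xb) mul1r.
rewrite fub [RHS]integral_mkcond; apply: eq_integral => y _.
rewrite patchE; case: ifPn => [|yab]; last first.
  rewrite integral0_eq// => x _; rewrite /k/gt/= patchE (negbTE yab) !mulr0//.
rewrite inE/= in_itv/= => /andP[ay yb].
(* In the other order [y] is fixed, and [x] runs over [[y, b]]. *)
transitivity (\int[mu]_x ((g y)%:E * (\1_(`[y, b] : set R) x)%:E))%E.
  apply: eq_integral => x _.
  rewrite /k/= /gt patchE mem_set/= ?in_itv/= ?ay// !indicE !mem_setE !in_itv/=.
  rewrite -EFinM; congr EFin.
  case: (leP y x) => yx/=; last by rewrite mul0r !mulr0.
  by rewrite (le_trans ay yx)/= mul1r mulrC.
rewrite integralZl//; last exact: integrable_indic_itv.
rewrite integral_indic// setIT /= lebesgue_measure_itv/= lte_fin.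
move: yb; rewrite le_eqVlt => /predU1P[->|yb].
  by rewrite ltxx mule0 subrr mul0r.
by rewrite yb -EFinB -EFinM mulrC.
Qed.

Lemma continuous_integrable_itv (R : realType) (a b : R) (f : R -> R) :
  (forall x, a <= x <= b -> {for x, continuous f}) ->
  (@lebesgue_measure R).-integrable `[a, b] (EFin \o f).
Proof.
move=> cf; apply: continuous_compact_integrable; first exact: segment_compact.
by apply: continuous_in_subspaceT => x /[!inE]/=; rewrite in_itv/= => /cf.
Qed.

(** The degenerate case [a = b] is included because the identity in [W11] is also required at the
    left end point. *)
Lemma Rintegral_derive (R : realType) (a b : R) (f F : R -> R) : a <= b ->
  (forall x, a <= x <= b -> {for x, continuous f}) ->
  (forall x, a <= x <= b -> is_derive x 1 F (f x)) ->
  Rintegral (@lebesgue_measure R) `[a, b] f = F b - F a.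
Proof.
rewrite le_eqVlt => /predU1P[<-|ab] cf dF.
  by rewrite set_itv1 Rintegral_set1 subrr.
have cF x : a <= x <= b -> {for x, continuous F}.
  move=> xab; apply/differentiable_continuous/derivable1_diffP.
  by have [] := dF _ xab.
rewrite /Rintegral (@continuous_FTC2 _ f F)//.
- by apply: continuous_in_subspaceT => x /[!inE]/=; rewrite in_itv/= => /cf.
- split.
  + move=> x; rewrite in_itv/= => /andP[ax xb].
    by have [] := dF x; rewrite ?ltW.
  + by apply/cvg_at_right_filter/cF; rewrite lexx ltW.
  + by apply/cvg_at_left_filter/cF; rewrite lexx ltW.
- move=> x; rewrite in_itv/= => /andP[ax xb].
  by rewrite derive1E; have [] := dF x; rewrite ?ltW.
Qed.

(** * The area under a circular arc *)

Lemma continuous_circle (R : realType) (r : R) :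
  continuous (fun x : R => Num.sqrt (r ^+ 2 - x ^+ 2)).
Proof.
move=> x; apply: continuous_comp; last exact: sqrt_continuous.
by apply: cvgB; [exact: cvg_cst|exact: exprn_continuous].
Qed.

Lemma asinN (R : realType) (x : R) : -1 <= x <= 1 -> asin (- x) = - asin x.
Proof.
move=> x1; rewrite -[in LHS](asinK (x := x)) ?in_itv//= -sinN sinK//.
by rewrite in_itv/= lerNl opprK lerNl asin_lepi2// asin_geNpi2.
Qed.

(** The sine of [acos b] is [sqrt (1 - b^2)], and [acos b] lies in the range of [asin]: if it
    exceeded [pi / 2], the monotonicity of cosine would make [b] negative. *)
Lemma asin_sqrt1B (R : realType) (b : R) : 0 <= b <= 1 ->
  asin (Num.sqrt (1 - b ^+ 2)) = acos b.
Proof.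
move=> /andP[b0 b1].
have b11 : -1 <= b <= 1 by rewrite b1 (le_trans _ b0)// lerN10.
rewrite -sin_acos// sinK// in_itv/=; apply/andP; split.
  by rewrite (le_trans _ (acos_ge0 b11))// oppr_le0 divr_ge0 ?pi_ge0.
rewrite leNgt; apply/negP => pib.
have : cos (acos b) < cos (pi / 2).
  rewrite ltr_cos ?in_itv//= ?acos_ge0 ?acos_lepi//.
  by have := pi_ge0 R; lra.
by rewrite acosK ?in_itv//= cos_pihalf ltNge b0.
Qed.

Lemma Rintegral_circle (R : realType) (r q : R) : 0 < q < r ->
  Rintegral (@lebesgue_measure R) `[-q, q]
    (fun x => Num.sqrt (r ^+ 2 - x ^+ 2)) =
  r ^+ 2 * asin (q / r) + q * Num.sqrt (r ^+ 2 - q ^+ 2).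
Proof.
move=> /andP[q0 qr]; have r0 := lt_trans q0 qr.
have qq : - q <= q by lra.
have dF x : - q <= x <= q -> is_derive x 1
    (fun t => (r ^+ 2 * asin (t / r) + t * Num.sqrt (r ^+ 2 - t ^+ 2)) / 2)
    (Num.sqrt (r ^+ 2 - x ^+ 2)).
  by move=> /andP[? ?]; apply: is_derive_circle_area => //; lra.
rewrite (Rintegral_derive qq (fun x _ => @continuous_circle _ r x) dF).
rewrite mulNr asinN ?sqrrN; first by field.
by rewrite ler_pdivlMr// ler_pdivrMr//; lra.
Qed.

(** * The calibration inequality and the area of the unit cap *)

(** Cauchy-Schwarz for the vectors [(1, h)] and [(y, - x)], the second of which has norm [r]. *)
Lemma circle_tangent_le (R : realType) (r x h : R) : 0 < r -> x ^+ 2 < r ^+ 2 ->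
  (Num.sqrt (r ^+ 2 - x ^+ 2) - x * h) / r <= Num.sqrt (1 + h ^+ 2).
Proof.
move=> r0 xr; have y0 : 0 < r ^+ 2 - x ^+ 2 by rewrite subr_gt0.
have y2 := sqr_sqrtr (ltW y0); move: y2; set y := Num.sqrt _ => y2.
(* The left side may be negative, so its absolute value is what gets squared. *)
rewrite ler_pdivrMr//; apply: (le_trans (ler_norm _)).
rewrite -ler_sqr ?nnegrE ?mulr_ge0 ?sqrtr_ge0 ?(ltW r0)//.
rewrite real_normK ?num_real// exprMn sqr_sqrtr; last by have := sqr_ge0 h; lra.
have -> : r ^+ 2 = y ^+ 2 + x ^+ 2 by rewrite y2 subrK.
(* Lagrange's identity; the remainder [(x + y * h) ^+ 2] also governs the equality case. *)
rewrite (_ : (1 + _) * _ = (y - x * h) ^+ 2 + (x + y * h) ^+ 2); last by ring.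
by rewrite lerDl sqr_ge0.
Qed.

(** Equality holds when the Lagrange remainder [x + y * h] vanishes, that is, when [h] is the slope
    of the circle at [x]. *)
Lemma circle_tangent_eq (R : realType) (r x h : R) : 0 < r -> x ^+ 2 < r ^+ 2 ->
  ((Num.sqrt (r ^+ 2 - x ^+ 2) - x * h) / r = Num.sqrt (1 + h ^+ 2)) <->
  h = - x / Num.sqrt (r ^+ 2 - x ^+ 2).
Proof.
move=> r0 xr; have y0 : 0 < r ^+ 2 - x ^+ 2 by rewrite subr_gt0.
have sy0 : 0 < Num.sqrt (r ^+ 2 - x ^+ 2) by rewrite sqrtr_gt0.
have y2 := sqr_sqrtr (ltW y0); move: y2 sy0; set y := Num.sqrt _ => y2 sy0.
have h1 : 0 <= 1 + h ^+ 2 by have := sqr_ge0 h; lra.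
split=> [E|hE].
  have E2 : (y - x * h) ^+ 2 = (1 + h ^+ 2) * r ^+ 2.
    by rewrite -(sqr_sqrtr h1) -E; field; rewrite gt_eqF.
  have : (x + y * h) ^+ 2 = 0.
    have -> : (x + y * h) ^+ 2 = (1 + h ^+ 2) * (x ^+ 2 + y ^+ 2) - (y - x * h) ^+ 2.
      by ring.
    by rewrite E2 y2; ring.
  move/eqP; rewrite sqrf_eq0 => /eqP xyh.
  by apply: (mulIf (lt0r_neq0 sy0)); rewrite divfK ?gt_eqF//; lra.
have -> : 1 + h ^+ 2 = (r / y) ^+ 2.
  rewrite hE !expr_div_n; have -> : r ^+ 2 = y ^+ 2 + x ^+ 2 by rewrite y2 subrK.
  by field; rewrite gt_eqF.
rewrite sqrtr_sqr ger0_norm ?divr_ge0 ?ltW// hE.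
apply: (mulIf (lt0r_neq0 r0)); rewrite divfK ?gt_eqF//.
apply: (mulIf (lt0r_neq0 sy0)).
have -> : r / y * r * y = r ^+ 2 by field; rewrite gt_eqF.
have -> : r ^+ 2 = y ^+ 2 + x ^+ 2 by rewrite y2 subrK.
by field; rewrite gt_eqF.
Qed.

(** This is the area of the cap of the unit circle meeting its chord at angle [acos b]. It is the
    value at [acos b] of [t - cos t * sin t], which vanishes at [0] and has derivative
    [2 * sin t ^+ 2]; the mean value theorem gives the sign. *)
Lemma cap_area_gt0 (R : realType) (b : R) : 0 < b < 1 ->
  0 < acos b - b * Num.sqrt (1 - b ^+ 2).
Proof.
move=> /andP[b0 b1].
have a0 : 0 < acos b by apply: acos_gt0; lra.
have api : acos b < pi by apply: acos_ltpi; lra.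
pose f (t : R) := t - cos t * sin t.
have df (x : R) : is_derive x 1 f (2 * sin x ^+ 2).
  apply: is_derive_eq; rewrite /GRing.scale /=.
  by have := cos2Dsin2 x; nra.
have cf : continuous f.
  move=> x; apply/differentiable_continuous/derivable1_diffP.
  by have [] := df x.
have [c + E] := MVT a0 (fun x _ => df x) (continuous_subspaceT cf).
rewrite in_itv/= => /andP[c0 ca].
have sc : 0 < sin c by apply: sin_gt0_pi; rewrite c0 (lt_trans ca).
move: E; rewrite /f sin0 mulr0 !subr0 acosK ?in_itv/= ?sin_acos; try lra.
by move=> ->; rewrite !mulr_gt0// exprn_gt0.
Qed.

(** * Integrability on a segment *)

Lemma integrable_itvZl (R : realType) (a b k : R) (f : R -> R) :
  (@lebesgue_measure R).-integrable `[a, b] (EFin \o f) ->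
  (@lebesgue_measure R).-integrable `[a, b] (EFin \o (fun x => k * f x)).
Proof. by move=> fi; have := integrableZl _ k fi; apply. Qed.

Lemma integrable_itvB (R : realType) (a b : R) (f g : R -> R) :
  (@lebesgue_measure R).-integrable `[a, b] (EFin \o f) ->
  (@lebesgue_measure R).-integrable `[a, b] (EFin \o g) ->
  (@lebesgue_measure R).-integrable `[a, b] (EFin \o (fun x => f x - g x)).
Proof. by move=> fi gi; have := integrableB _ fi gi; apply. Qed.

Lemma integrable_itvD (R : realType) (a b : R) (f g : R -> R) :
  (@lebesgue_measure R).-integrable `[a, b] (EFin \o f) ->
  (@lebesgue_measure R).-integrable `[a, b] (EFin \o g) ->
  (@lebesgue_measure R).-integrable `[a, b] (EFin \o (fun x => f x + g x)).
Proof. by move=> fi gi; have := integrableD _ fi gi; apply. Qed.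

Lemma integrable_mulX (R : realType) (a b : R) (g : R -> R) :
  (@lebesgue_measure R).-integrable `[a, b] (EFin \o g) ->
  (@lebesgue_measure R).-integrable `[a, b] (EFin \o (fun x => x * g x)).
Proof.
move=> ig; have iC := integrable_itvZl (`|a| + `|b|) ig.
apply: (le_integrable _ _ _ iC) => //.
- apply/measurable_EFinP/measurable_funM => //.
  by apply/measurable_EFinP; exact: measurable_int ig.
- move=> x /=; rewrite in_itv/= => /andP[ax xb].
  rewrite lee_fin !normrM ler_wpM2r// [leRHS]ger0_norm ?addr_ge0//.
  rewrite ler_norml; have := ler_norm b; have := ler_norm (- a).
  by rewrite normrN; have := normr_ge0 a; have := normr_ge0 b; lra.
Qed.

(** Dominated by [1 + |g|], so a finite arc length needs only an integrable derivative. *)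
Lemma integrable_arclength (R : realType) (a b : R) (g : R -> R) :
  (@lebesgue_measure R).-integrable `[a, b] (EFin \o g) ->
  (@lebesgue_measure R).-integrable `[a, b]
    (EFin \o (fun x => Num.sqrt (1 + g x ^+ 2))).
Proof.
move=> ig.
have mg : measurable_fun `[a, b] g.
  by apply/measurable_EFinP; exact: measurable_int ig.
have i1 : (@lebesgue_measure R).-integrable `[a, b] (EFin \o cst (1 : R)).
  by apply: continuous_integrable_itv => x _; exact: cst_continuous.
have iC := integrable_itvD i1 (integrable_norm ig).
apply: (le_integrable _ _ _ iC) => //.
- apply/measurable_EFinP; apply: (measurableT_comp (f := @Num.sqrt R)).
    exact: continuous_measurable_fun (@sqrt_continuous R).
  by apply: measurable_funD => //; exact: measurable_funX.
- move=> x _ /=; rewrite lee_fin [leLHS]ger0_norm ?sqrtr_ge0//.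
  rewrite -sqrtr_sqr ler_wsqrtr//.
  rewrite -[g x ^+ 2]real_normK ?num_real//.
  by have := normr_ge0 (g x); nra.
Qed.

(** * The energy of an arbitrary competitor *)

(** The area constraint read on the derivative: the area is the integral of [(q - x) * h x], and [h]
    has mean zero because [v] vanishes at both ends. *)
Lemma admissible_moment (R : realType) (q : R) (v h : R -> R) :
  admissible q v h ->
  Rintegral (@lebesgue_measure R) `[-q, q] (fun x => x * h x) = -1.
Proof.
move=> [q0 [[ih vE] [_ [vq [vNq v1]]]]].
have h0 : Rintegral (@lebesgue_measure R) `[-q, q] h = 0.
  by have := vE q; rewrite vq vNq add0r => <- //; lra.
have : (\int[@lebesgue_measure R]_(x in `[(- q)%R, q]) (v x)%:E =
    \int[@lebesgue_measure R]_(x in `[(- q)%R, q]) ((q - x) * h x)%:E)%E.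
  rewrite -(integral_primitive ih); apply: eq_integral.
  move=> x /[!inE]/=; rewrite in_itv/= => xq.
  by rewrite (vE _ xq) vNq add0r.
rewrite v1 => /(congr1 fine) /= E.
have : Rintegral (@lebesgue_measure R) `[-q, q] (fun x => q * h x - x * h x) = 1.
  rewrite [RHS]E; apply: eq_Rintegral => x _; ring.
rewrite RintegralB//; [|exact: integrable_itvZl|exact: integrable_mulX].
by rewrite RintegralZl// h0 mulr0 sub0r => /(congr1 -%R); rewrite opprK.
Qed.

(* The gap in the calibration inequality. *)
Definition defect (R : realType) (r : R) (h : R -> R) (x : R) : R :=
  Num.sqrt (1 + h x ^+ 2) - (Num.sqrt (r ^+ 2 - x ^+ 2) - x * h x) / r.

Lemma integrable_defect (R : realType) (a b r : R) (h : R -> R) :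
  (@lebesgue_measure R).-integrable `[a, b] (EFin \o h) ->
  (@lebesgue_measure R).-integrable `[a, b] (EFin \o defect r h).
Proof.
move=> ih.
have i1 : (@lebesgue_measure R).-integrable `[a, b]
    (EFin \o (fun x => Num.sqrt (r ^+ 2 - x ^+ 2))).
  by apply: continuous_integrable_itv => x _; exact: continuous_circle.
have i2 := integrable_itvB i1 (integrable_mulX ih).
have i3 := integrable_itvZl r^-1 i2.
have := integrable_itvB (integrable_arclength ih) i3.
apply: eq_integrable => // x _ /=.
by rewrite /defect /= mulrC.
Qed.

(** The arc length integrand is split into its calibration and the defect; the calibration
    integrates to an explicit function of [q] by the moment identity. An exact identity, rather than
    a bound, yields both minimality and uniqueness. *)
Lemma Jfun_defect (R : realType) (b q : R) (v h : R -> R) :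
  0 < b < 1 -> admissible q v h ->
  let s := Num.sqrt (1 - b ^+ 2) in
  Jfun b q h = (q / s * (acos b - b * s) + s / q +
    Rintegral (@lebesgue_measure R) `[-q, q] (defect (q / s) h))%:E.
Proof.
move=> b01 adm s; have [q0 [[ih _] _]] := adm.
have s0 : 0 < s by rewrite sqrtr_gt0; nra.
have s2 : s ^+ 2 = 1 - b ^+ 2 by rewrite sqr_sqrtr//; nra.
have s1 : s < 1 by nra.
pose r := q / s; have r0 : 0 < r by rewrite divr_gt0.
have qE : q = s * r by rewrite /r; field; rewrite gt_eqF.
have qr : 0 < q < r by rewrite q0 qE gtr_pMl.
have iD := integrable_defect r ih.
have i1 : (@lebesgue_measure R).-integrable `[-q, q]
    (EFin \o (fun x => Num.sqrt (r ^+ 2 - x ^+ 2))).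
  by apply: continuous_integrable_itv => x _; exact: continuous_circle.
have i2 := integrable_itvB i1 (integrable_mulX ih).
have ib : (@lebesgue_measure R).-integrable `[-q, q] (EFin \o cst b).
  by apply: continuous_integrable_itv => x _; exact: cst_continuous.
have i3 := integrable_itvZl r^-1 i2.
have i4 := integrable_itvB i3 ib.
have -> : Jfun b q h = (Rintegral (@lebesgue_measure R) `[-q, q]
    (fun x => Num.sqrt (1 + h x ^+ 2) - b))%:E.
  rewrite /Rintegral fineK//; apply: integrable_fin_num => //.
  exact: (integrable_itvB (integrable_arclength ih) ib).
congr EFin; rewrite -/r.
transitivity (Rintegral (@lebesgue_measure R) `[-q, q]
   (fun x => (r^-1 * (Num.sqrt (r ^+ 2 - x ^+ 2) - x * h x) - b) + defect r h x)).
  by apply: eq_Rintegral => x _; rewrite /defect; ring.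
rewrite RintegralD// RintegralB// RintegralZl// RintegralB//; last exact: integrable_mulX.
rewrite (admissible_moment adm) Rintegral_circle// Rintegral_cst//.
rewrite /= lebesgue_measure_itv/= lte_fin gtrN// /=.
(* The radius was chosen so that the arc meets its chord at angle [acos b]; hence the [asin] term
   becomes [acos b] and the height at [q] is [b * r]. *)
have -> : q / r = s by rewrite qE mulfK ?gt_eqF.
rewrite asin_sqrt1B; last by lra.
have -> : Num.sqrt (r ^+ 2 - q ^+ 2) = b * r.
  have -> : r ^+ 2 - q ^+ 2 = (b * r) ^+ 2 by rewrite qE !exprMn s2; ring.
  by rewrite sqrtr_sqr ger0_norm// mulr_ge0 ?ltW//; lra.
congr (_ + _); rewrite qE; field.
by rewrite !gt_eqF.
Qed.

(** * The circular cap of unit area: admissibility, minimality, uniqueness *)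

Section cap.
Variables (R : realType) (b r : R).
Hypothesis b01 : 0 < b < 1.
Let s := Num.sqrt (1 - b ^+ 2).
Hypothesis r0 : 0 < r.
(** The cap of radius [r] has [r ^+ 2] times the area of the unit cap, so this fixes its area to be
    1. *)
Hypothesis rA : r ^+ 2 * (acos b - b * s) = 1.
Let mu := @lebesgue_measure R.
Let y (x : R) := Num.sqrt (r ^+ 2 - x ^+ 2).
Let u (x : R) := y x - b * r.
Let g (x : R) := - x / y x.

Let s0 : 0 < s. Proof. by rewrite sqrtr_gt0; move: b01; nra. Qed.

Let s2 : s ^+ 2 = 1 - b ^+ 2.
Proof. by rewrite sqr_sqrtr//; move: b01; nra. Qed.

Let s1 : s < 1. Proof. by move: s2 s0 b01; nra. Qed.

Let p0 : 0 < s * r. Proof. exact: mulr_gt0. Qed.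

Let pr : s * r < r. Proof. by rewrite gtr_pMl. Qed.

Let x2r2 x : - (s * r) <= x <= s * r -> x ^+ 2 < r ^+ 2.
Proof. by move: p0 pr; nra. Qed.

Let y_gt0 x : - (s * r) <= x <= s * r -> 0 < y x.
Proof. by move=> /x2r2 xr; rewrite sqrtr_gt0 subr_gt0. Qed.

Let y_end : y (s * r) = b * r.
Proof.
rewrite /y (_ : r ^+ 2 - _ = (b * r) ^+ 2); last by rewrite !exprMn s2; ring.
by rewrite sqrtr_sqr ger0_norm// mulr_ge0 ?(ltW r0)//; move: b01; lra.
Qed.

Lemma is_derive_cap x : - (s * r) <= x <= s * r -> is_derive x 1 u (g x).
Proof.
move=> /x2r2 xr; have dy := is_derive_circle xr.
by apply: is_derive_eq; rewrite /GRing.scale /= /g /y; ring.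
Qed.

Let g_continuous x : - (s * r) <= x <= s * r -> {for x, continuous g}.
Proof.
move=> xp; apply: (@cvgM _ _ _ _ -%R (fun z => (y z)^-1)).
  exact: opp_continuous.
apply: cvgV; first by rewrite gt_eqF ?y_gt0.
exact: continuous_circle.
Qed.

Let g_integrable : mu.-integrable `[- (s * r), s * r] (EFin \o g).
Proof. exact: continuous_integrable_itv g_continuous. Qed.

Let uN x : u (- x) = u x. Proof. by rewrite /u /y sqrrN. Qed.

Let u_end : u (s * r) = 0. Proof. by rewrite /u y_end subrr. Qed.

Lemma cap_admissible : admissible (s * r) u g.
Proof.
split=> //; split; [split=> // x /andP[px xp]|split; [|split; [|split]]].
- have dU z : - (s * r) <= z <= x -> is_derive z 1 u (g z).
    by move=> /andP[? ?]; apply: is_derive_cap; lra.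
  have cg z : - (s * r) <= z <= x -> {for z, continuous g}.
    by move=> /andP[? ?]; apply: g_continuous; lra.
  by rewrite (Rintegral_derive px cg dU) addrC subrK.
(* The arc is lowest at the ends of its chord, where its height is [b * r]. *)
- move=> x xp; rewrite subr_ge0 -y_end ler_wsqrtr// lerD2l lerN2.
  by move: xp p0; nra.
- exact: u_end.
- by rewrite uN u_end.
have iy : mu.-integrable `[- (s * r), s * r] (EFin \o y).
  by apply: continuous_integrable_itv => x _; exact: continuous_circle.
have ib : mu.-integrable `[- (s * r), s * r] (EFin \o cst (b * r)).
  by apply: continuous_integrable_itv => x _; exact: cst_continuous.
have iu := integrable_itvB iy ib.
have u1 : Rintegral mu `[- (s * r), s * r] u = 1.
  rewrite RintegralB// Rintegral_circle ?p0 ?pr// -/(y _) y_end Rintegral_cst//.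
  rewrite /= lebesgue_measure_itv/= lte_fin gtrN// /=.
  rewrite mulfK ?gt_eqF// asin_sqrt1B; last by move: b01; lra.
  by rewrite -rA -/s; ring.
by rewrite -u1 /Rintegral fineK//; exact: integrable_fin_num.
Qed.

Let areaE : acos b - b * s = (r ^+ 2)^-1.
Proof.
have r20 : r ^+ 2 != 0 by rewrite gt_eqF ?exprn_gt0.
by apply: (mulfI r20); rewrite rA divff.
Qed.

(** The defect of the cap vanishes pointwise, and at [q = s * r] each of the two explicit terms
    equals [1 / r]. *)
Lemma Jfun_cap : Jfun b (s * r) g = (2 / r)%:E.
Proof.
rewrite (Jfun_defect b01 cap_admissible) -/s.
rewrite [s * r / s]mulrAC divff ?gt_eqF// mul1r.
have -> : Rintegral mu `[- (s * r), s * r] (defect r g) = 0.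
  rewrite (@eq_Rintegral _ _ _ _ _ (cst 0)) ?Rintegral_cst ?mul0r//.
  move=> x /[!inE]/=; rewrite in_itv/= => xp.
  rewrite /defect; apply/eqP; rewrite subr_eq0 eq_sym; apply/eqP.
  exact/(circle_tangent_eq _ r0 (x2r2 xp)).
by rewrite addr0 areaE; congr EFin; field; rewrite !gt_eqF.
Qed.

(** AM-GM with its remainder as an explicit square, which vanishes only at [q / s = r]. *)
Let energyE q : 0 < q ->
  q / s * (acos b - b * s) + s / q = 2 / r + (q / s - r) ^+ 2 / (q / s * r ^+ 2).
Proof.
by move=> q0; rewrite areaE; field; rewrite !gt_eqF.
Qed.

Let xq q x : 0 < q -> - q <= x <= q -> x ^+ 2 < (q / s) ^+ 2.
Proof.
move=> q0 xq; have : q < q / s by rewrite ltr_pdivlMr// gtr_pMr.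
by nra.
Qed.

Let defect_ge0 q h x : 0 < q -> - q <= x <= q -> 0 <= defect (q / s) h x.
Proof.
by move=> q0 xqq; rewrite subr_ge0 circle_tangent_le ?divr_gt0 ?xq.
Qed.

Let Rintegral_defect_ge0 q h : 0 < q ->
  0 <= Rintegral mu `[- q, q] (defect (q / s) h).
Proof.
move=> q0; apply: Rintegral_ge0 => x /=; rewrite in_itv/=.
exact: defect_ge0.
Qed.

Lemma Jfun_cap_le q v h : admissible q v h ->
  (Jfun b (s * r) g <= Jfun b q h)%E.
Proof.
move=> adm; have q0 : 0 < q by case: adm.
rewrite Jfun_cap (Jfun_defect b01 adm) -/s lee_fin (energyE q0) -addrA lerDl.
rewrite addr_ge0 ?Rintegral_defect_ge0// divr_ge0 ?sqr_ge0//.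
by rewrite mulr_ge0 ?sqr_ge0// divr_ge0 ?ltW.
Qed.

(** The excess of energy over the cap is a sum of two nonnegative terms: the AM-GM remainder
    determines the width, and the integrated defect determines the derivative almost everywhere. *)
Lemma Jfun_cap_unique q v h : admissible q v h ->
  (Jfun b q h <= Jfun b (s * r) g)%E ->
  q = s * r /\ forall x, - q <= x <= q -> v x = u x.
Proof.
move=> adm; have [q0 [[ih vE] [_ [_ [vq _]]]]] := adm.
rewrite Jfun_cap (Jfun_defect b01 adm) -/s lee_fin (energyE q0) -addrA gerDl.
set A := _ / _; set D := Rintegral _ _ _ => AD.
have D0 : 0 <= D by exact: Rintegral_defect_ge0.
have A0 : 0 <= A.
  by rewrite divr_ge0 ?sqr_ge0// mulr_ge0 ?sqr_ge0// divr_ge0 ?ltW.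
have /eqP : A = 0 by lra.
rewrite /A mulf_eq0 sqrf_eq0 subr_eq0 invr_eq0 mulf_eq0 sqrf_eq0.
rewrite [q / s == 0]gt_eqF ?divr_gt0// (gt_eqF r0) !orbF => /eqP qsr.
have qE : q = s * r by rewrite -qsr mulrC divfK// gt_eqF.
have D00 : D = 0 by lra.
split=> // x xqq; have [_ [[_ uE] _]] := cap_admissible.
rewrite vE// uE -?qE// vq qE uN u_end -qE; congr (_ + _).
have iD := integrable_defect r ih.
have ig' : mu.-integrable `[- q, q] (EFin \o g) by rewrite qE; exact: g_integrable.
(* A nonnegative function with zero integral vanishes almost everywhere, and zero defect forces the
   slope of the circle. *)
have hg : ae_eq mu `[- q, q]%classic (EFin \o h) (EFin \o g).
  have : ae_eq mu `[- q, q]%classic (EFin \o defect r h) (cst 0%E).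
    apply/ae_eq_integral_abs => //; first exact: measurable_int iD.
    rewrite -[RHS]/(0%:E) -D00 /D qsr /Rintegral fineK; last exact: integrable_fin_num.
    apply: eq_integral => z /[!inE]/=; rewrite in_itv/= => zq.
    by rewrite ger0_norm// -qsr defect_ge0.
  apply: filterS => z /= + zq => /(_ zq) [].
  move: zq; rewrite in_itv/= qE => zq /eqP; rewrite subr_eq0 eq_sym => /eqP.
  by move=> /(circle_tangent_eq _ r0 (x2r2 zq)) ->.
(* Both functions vanish at [- q]; derivatives equal almost everywhere give the same integral up to
   [x]. *)
rewrite /Rintegral; congr fine.
have sub : `[- q, x] `<=` `[- q, q] by apply: subset_itvl; rewrite bnd_simp; lra.
apply: ae_eq_integral => //.
- by apply: measurable_int; apply: integrableS ih.
- by apply: measurable_int; apply: integrableS ig'.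
- exact: ae_eq_subset hg.
Qed.
End cap.

(** * Smoothness of the cap *)

(** With [y] the height of the circle and [y' = - x / y], functions of the form [P / y ^+ k] are
    closed under differentiation: the new numerator is [P' * y ^+ 2 + k * x * P] and the exponent
    grows by two. *)
Lemma is_derive_horner_circle (R : realType) (r x : R) (P : {poly R}) (k : nat) :
  x ^+ 2 < r ^+ 2 ->
  is_derive x 1 (fun t => P.[t] * (Num.sqrt (r ^+ 2 - t ^+ 2))^-1 ^+ k)
    ((P^`() * ((r ^+ 2)%:P - 'X^2) + k%:R *: ('X * P)).[x] *
     (Num.sqrt (r ^+ 2 - x ^+ 2))^-1 ^+ k.+2).
Proof.
move=> xr; have dc := is_derive_circle xr; have dP := is_derive_poly P x.
have y0 : 0 < r ^+ 2 - x ^+ 2 by rewrite subr_gt0.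
have sy0 : 0 < Num.sqrt (r ^+ 2 - x ^+ 2) by rewrite sqrtr_gt0.
have dV := @is_deriveV _ (fun t => Num.sqrt (r ^+ 2 - t ^+ 2)) _ _ _
  (lt0r_neq0 sy0) dc.
have := is_deriveX k dV; rewrite exprfctE => dX.
apply: (is_derive_eq (is_deriveM dP dX)); 
rewrite !(hornerD, hornerN, hornerM, hornerC, hornerXn, hornerX, hornerZ).
rewrite /GRing.scale /=.
have := sqr_sqrtr (ltW y0); move: sy0; set y := Num.sqrt _ => sy0 <-.
(* The exponent [k - 1] from the power rule is genuine only for positive [k]. *)
clear dX; case: k => [|k].
  by rewrite /=; field; rewrite gt_eqF.
by rewrite /= -natr1 !exprS; field; rewrite gt_eqF.
Qed.

Lemma near_sqr_lt (R : realType) (r x : R) : x ^+ 2 < r ^+ 2 ->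
  \forall z \near x, z ^+ 2 < r ^+ 2.
Proof. by move=> xr; apply: (cvgr_lt _ (@exprn_continuous R 2 x)). Qed.

(** The closed form starts at the first derivative, where the constant [c] has disappeared. [P] and
    [k] do not depend on [x], so the formula can be differentiated again. *)
Lemma derive1n_cap (R : realType) (r c : R) (n : nat) :
  exists (P : {poly R}) (k : nat), forall x, x ^+ 2 < r ^+ 2 ->
    derive1n n.+1 (fun t => Num.sqrt (r ^+ 2 - t ^+ 2) - c) x =
    P.[x] * (Num.sqrt (r ^+ 2 - x ^+ 2))^-1 ^+ k.
Proof.
elim: n => [|n [P [k IH]]].
  exists (- 'X), 1%N => x xr; rewrite derive1n1 derive1E.
  have dc := is_derive_circle xr.
  by rewrite derive_val /GRing.scale /= !hornerE expr1 subr0.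
eexists; exists k.+2 => x xr; rewrite derive1nS derive1E.
have := is_derive_horner_circle P k xr.
move=> /(near_eq_is_derive (g := derive1n n.+1 (fun t => Num.sqrt (r ^+ 2 - t ^+ 2) - c))).
case; last by move=> _ ->.
(* The formula holds near [x], not only at [x], because the condition on [x] is open. *)
by near=> z; rewrite IH//; near: z; exact: near_sqr_lt.
Unshelve. all: by end_near. Qed.

(** The open interval of radius [r] contains the closed chord, so this gives two-sided derivatives
    of every order even at the ends of the chord. *)
Lemma derivable_derive1n_cap (R : realType) (r c : R) (n : nat) (x : R) :
  x ^+ 2 < r ^+ 2 ->
  derivable (derive1n n (fun t => Num.sqrt (r ^+ 2 - t ^+ 2) - c)) x 1.
Proof.
move=> xr; case: n => [|n].
  have dc := is_derive_circle xr.
  by rewrite derive1n0; apply: derivableB.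
have [P [k E]] := derive1n_cap r c n.
have [+ _] := is_derive_horner_circle P k xr.
apply: near_eq_derivable.
by near=> z; rewrite E//; near: z; exact: near_sqr_lt.
Unshelve. all: by end_near. Qed.

Unset Implicit Arguments.

(** * Assembly, with the contact angle *)

Theorem mainTheorem5 (R : realType) (beta : R) :
  0 < beta < 1 ->
  let Rr : R := (Num.sqrt (acos beta - beta * Num.sqrt (1 - beta ^+ 2)))^-1 in
  let p0 : R := Num.sqrt (1 - beta ^+ 2) * Rr in
  let u0 : R -> R := fun x => Num.sqrt (Rr ^+ 2 - x ^+ 2) - beta * Rr in
  [/\ minimizer beta p0 u0,
      (forall p u, minimizer beta p u ->
         p = p0 /\ forall x, -p <= x <= p -> u x = u0 x),
      (forall (n : nat) x, -p0 <= x <= p0 -> derivable (derive1n n u0) x 1),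
      1 / Num.sqrt (1 + (derive1 u0 p0) ^+ 2) = beta &
      1 / Num.sqrt (1 + (derive1 u0 (-p0)) ^+ 2) = beta].
Proof.
move=> b01; set s := Num.sqrt (1 - beta ^+ 2) => Rr p0 u0.
have A0 := cap_area_gt0 b01; rewrite -/s in A0.
have r0 : 0 < Rr by rewrite invr_gt0 sqrtr_gt0.
have rA : Rr ^+ 2 * (acos beta - beta * s) = 1.
  by rewrite exprVn sqr_sqrtr ?ltW// mulVf// gt_eqF.
have s0 : 0 < s by rewrite sqrtr_gt0; nra.
have s2 : s ^+ 2 = 1 - beta ^+ 2 by rewrite sqr_sqrtr//; nra.
have p00 : 0 < p0 by rewrite mulr_gt0.
have p0r : p0 ^+ 2 < Rr ^+ 2.
  by rewrite exprMn s2 gtr_pMl ?exprn_gt0// gtrDl oppr_lt0 exprn_gt0//; case/andP: b01.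
have adm := cap_admissible b01 r0 rA.
(* Only the square of the slope enters, so both ends are treated at once. *)
have angle x : x ^+ 2 = p0 ^+ 2 -> 1 / Num.sqrt (1 + (derive1 u0 x) ^+ 2) = beta.
  move=> xp; have xr : x ^+ 2 < Rr ^+ 2 by rewrite xp.
  have dc := is_derive_circle xr.
  have -> : derive1 u0 x = - x / Num.sqrt (Rr ^+ 2 - x ^+ 2).
    by rewrite derive1E derive_val subr0.
  rewrite expr_div_n sqrrN xp sqr_sqrtr; last by rewrite subr_ge0 ltW.
  (* The squared slope is [s ^+ 2 / beta ^+ 2], and [s ^+ 2 + beta ^+ 2 = 1]. *)
  have -> : 1 + p0 ^+ 2 / (Rr ^+ 2 - p0 ^+ 2) = beta^-1 ^+ 2.
    have -> : Rr ^+ 2 - p0 ^+ 2 = (beta * Rr) ^+ 2.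
      by rewrite /p0 !exprMn s2; ring.
    rewrite /p0 [(s * _) ^+ 2]exprMn s2; field.
    by rewrite (gt_eqF r0) gt_eqF//; case/andP: b01.
  by rewrite sqrtr_sqr ger0_norm ?invr_ge0 ?div1r ?invrK//; lra.
split.
- exists (fun x => - x / Num.sqrt (Rr ^+ 2 - x ^+ 2)); split; first exact: adm.
  by move=> q v h; exact: Jfun_cap_le.
(* A minimizer has energy at most that of the admissible cap, which is what the uniqueness lemma
   asks for. *)
- move=> p u [g [admu min]].
  exact: (Jfun_cap_unique b01 r0 rA admu (min _ _ _ adm)).
- move=> n x xp; apply: derivable_derive1n_cap; nra.
- exact: angle.
- by apply: angle; rewrite sqrrN.
Qed.
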